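(* Let $n \geq 1$ and $b \geq 2$ be integers and let $k \in \{0,1,\dots,b-1\}$. Then $$\left| \frac{1}{n!}\sum_{r \equiv k \ (\mathrm{mod}\ b)} A(n,r) - \frac{1}{b} \right| \leq \frac{1}{b} \sum_{j \in \mathbb{Z},\, j \neq 0} \left| \frac{b \sin(\pi j/b)}{\pi j} \right|^{n+1}.$$
   Context: A permutation $\pi$ of $\{1,\dots,n\}$ has a descent at position $i$, where $1 \leq i \leq n-1$, if $\pi(i) > \pi(i+1)$. The Eulerian number $A(n,r)$ is the number of permutations of $\{1,\dots,n\}$ with exactly $r$ descents (so $A(n,r)=0$ unless $0\le r\le n-1$, and the sum over $r$ is finite). *)

(* Defs.v *)
From mathcomp Require Import all_boot all_fingroup.

Set Implicit Arguments.
Unset Strict Implicit.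
Unset Printing Implicit Defensive.

(* Positions and values are 0-based: 'S_n permutes {0, ..., n-1}, and i is a
   descent of s when i.+1 < n and s i > s i.+1; shifting both by one gives the
   usual descents of a permutation of {1, ..., n}. *)
Definition descents (n : nat) (s : 'S_n) : {set 'I_n} :=
  [set i : 'I_n | [exists j : 'I_n, (val j == i.+1) && (s j < s i)]].

Definition eulerian (n r : nat) : nat :=
  #|[set s : 'S_n | #|descents s| == r]|.

(* The r-range is finite: eulerian n r = 0 for n <= r when 0 < n. *)
Definition eulerian_residue_sum (n b k : nat) : nat :=
  \sum_(0 <= r < n | r == k %[mod b]) eulerian n r.

(* Main.v *)
Require Import Defs.
From mathcomp Require Import all_boot all_order all_algebra.
From mathcomp Require Import all_classical all_reals all_analysis.
From mathcomp Require Import all_fingroup complex ring lra.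

Set Implicit Arguments.
Unset Strict Implicit.
Unset Printing Implicit Defensive.

Import Order.TTheory GRing.Theory Num.Theory.
Import numFieldNormedType.Exports ComplexField.Normc.

Local Open Scope classical_set_scope.
Local Open Scope ring_scope.

(** Write [A_n(y)] for the generating polynomial of the permutations of [n]
letters by number of descents, and [x_l = pi l / b].  The [b]-th roots of
unity are the [expi (2 x_l)], and filtering [A_n] by them expresses the sum
over the residue class of [k] as [1/b] times a sum over [l < b].  The term
[l = 0] is [A_n(1) = n!] and gives the [1/b] of the statement; what remains
is at most [1/b] times the sum over [0 < l < b] of
[q(x_l) = |A_n(expi (2 x_l))| / n!] (lemma [residue_sum_le]).  Splitting the
series over [j] along [j = l + m b] reduces the theorem to the pointwise bound
[q(x) <= S(x)] for [0 < x < pi], where, with [p = n + 1],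
[S(x)] is the sum over the integers [m] of [|sin x / (x + pi m)| ^ p]
(lemma [le_sinc_series]).

This bound could be read off the partial fraction expansion of the
derivatives of the cotangent.  Herglotz' trick replaces that expansion
by the duplication [y -> y^2], [x -> x/2, (x + pi)/2]:

- the rational function [y A_n(y) / (1 - y)^p], the image of [1 / (1 - y)] by
  [n] applications of [y d/dy], satisfies
  [B(y) + B(-y) = 2^p B(y^2)] (lemma [descent_poly_duplication]).  On the unit
  circle, the triangle inequality turns this into
  [q(x) <= |cos(x/2)|^p q(x/2) + |sin(x/2)|^p q((x + pi)/2)];

- [S] satisfies the same relation with equality, by separating even and odd
  [m] (lemma [sinc_series_duplication]);

- [q <= 1], whereas the term of [S] whose pole [0] or [pi] is nearest to [x] is
  already at least [1 - p sin x] (lemma [one_sub_sinc_pow_le]).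

Hence [q <= S + p sin], and each use of the duplication relation
multiplies the error by at most [3/4], because
[c^p s + s^p c <= c s (c + s) <= (3/4) (2 c s)] for [c = cos(x/2)],
[s = sin(x/2)] and [p >= 2]. *)

(** * Descents under insertion of the largest letter *)

Fixpoint word_descents (w : seq nat) : nat :=
  if w is a :: v then
    ((if v is b :: _ then (b < a)%N else false) + word_descents v)%N
  else 0%N.

Lemma word_descents_cons2 a b v :
  word_descents [:: a, b & v] = ((b < a) + word_descents (b :: v))%N.
Proof. by []. Qed.

Definition insert_letter (m i : nat) (w : seq nat) : seq nat :=
  take i w ++ m :: drop i w.

Lemma insert_letter0 m w : insert_letter m 0 w = m :: w.
Proof. by rewrite /insert_letter take0 drop0. Qed.

Lemma insert_letterS m i a w :
  insert_letter m i.+1 (a :: w) = a :: insert_letter m i w.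
Proof. by []. Qed.

(** A letter larger than all the others creates no new descent at the end of
the word or inside an existing descent, and exactly one at each remaining
place. *)
Lemma sum_insert_letter_descents (F : comNzRingType) (x : F) m w :
  all (fun a => a < m)%N w ->
  \sum_(i < (size w).+1) x ^+ word_descents (insert_letter m i w) =
  (word_descents w).+1%:R * x ^+ word_descents w +
  ((size w)%:R - (word_descents w)%:R) * x ^+ (word_descents w).+1.
Proof.
elim: w => [_|a [|b v] IHw].
- by rewrite big_ord_recl big_ord0 /= expr0; ring.
- rewrite /= andbT => am; rewrite !big_ord_recl big_ord0 /= am.
  by rewrite [(m < a)%N]ltnNge (ltnW am) /=; ring.
  (* The places before [b] are split off on both sides; the others give, up
     to the factor [x] recording a descent from [a] to [b], the same sum as
     for the tail [b :: v]. *)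
- move=> /andP[am bvm]; have := IHw bvm.
  case/andP: (bvm) => bm _.
  rewrite big_ord_recl insert_letter0 !word_descents_cons2 bm add1n => IH.
  rewrite 2!big_ord_recl insert_letter0 insert_letterS insert_letter0.
  rewrite !word_descents_cons2 am bm [(m < a)%N]ltnNge (ltnW am) !add1n add0n.
  under [X in _ + (_ + X)]eq_bigr => i _ do
    rewrite !insert_letterS word_descents_cons2 -insert_letterS exprD.
  rewrite -mulr_sumr; set S := bigop _ _ _ in IH *.
  move: (word_descents _) S IH => d S /(canRL (addKr _)) ->.
  by case: (b < a)%N; rewrite /= ?add0n ?add1n !exprS;
    move: (x ^+ d) => y; ring.
Qed.

Definition perm_word n (s : 'S_n) : seq nat := [seq val (s i) | i <- enum 'I_n].

Lemma size_perm_word n (s : 'S_n) : size (perm_word s) = n.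
Proof. by rewrite size_map size_enum_ord. Qed.

Lemma nth_perm_word n (s : 'S_n) (i : 'I_n) : nth 0%N (perm_word s) i = s i.
Proof. by rewrite (nth_map i) ?size_enum_ord// nth_ord_enum. Qed.

Lemma word_descentsE w : word_descents w =
  (\sum_(i < size w) ((i.+1 < size w) && (nth 0 w i.+1 < nth 0 w i)))%N.
Proof.
elim: w => [|a v IHv]; first by rewrite big_ord0.
rewrite /= big_ord_recl /= IHv; congr (_ + _)%N.
by case: v {IHv} => [|b v].
Qed.

Lemma card_descents n (s : 'S_n) : #|descents s| = word_descents (perm_word s).
Proof.
rewrite word_descentsE size_perm_word -sum1_card big_mkcond /=.
apply: eq_bigr => i _; rewrite inE nth_perm_word.
case: existsP => [[j /andP[/eqP ji sji]]|nj].
  by rewrite -ji ltn_ord nth_perm_word sji.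
case: ltnP => //= lt_i; case: ltnP => // lt_s; case: nj.
by exists (Ordinal lt_i); rewrite /= eqxx -nth_perm_word.
Qed.

Lemma perm_word_lift n (i : 'I_n.+1) (s : 'S_n) :
  perm_word (lift_perm i ord_max s) = insert_letter n i (perm_word s).
Proof.
have ile : (i <= n)%N by rewrite -ltnS.
have szt : size (take i (perm_word s)) = i.
  by rewrite size_takel// size_perm_word.
apply: (@eq_from_nth _ 0%N) => [|j].
  by rewrite size_cat /= szt size_drop !size_perm_word addnS subnKC.
rewrite size_perm_word => ltj.
rewrite -[j]/(nat_of_ord (Ordinal ltj)) nth_perm_word.
rewrite nth_cat szt; case: (unliftP i (Ordinal ltj)) => [k|] ->; last first.
  by rewrite lift_perm_id ltnn subnn.
rewrite lift_perm_lift /= /bump [(n <= _)%N]leqNgt ltn_ord add0n -nth_perm_word.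
case: (ltnP k i) => ki; first by rewrite add0n ki nth_take.
by rewrite add1n ltnNge (leqW ki) /= subSn //= nth_drop subnKC.
Qed.

Lemma perm_word_lt n (s : 'S_n) : all (fun a => a < n)%N (perm_word s).
Proof. by apply/allP => a /mapP[i _ ->]; exact: ltn_ord. Qed.

Definition descent_poly (F : nzRingType) n : {poly F} :=
  \sum_(s : 'S_n) 'X^#|descents s|.

Lemma descent_poly0 (F : nzRingType) : descent_poly F 0 = 1.
Proof.
rewrite /descent_poly (bigD1 1%g) //= big1 => [|s]; last by rewrite permS0 eqxx.
rewrite addr0 (_ : #|_| = 0)%N ?expr0 //.
by apply/eqP; rewrite cards_eq0; apply/eqP/finset.setP => -[].
Qed.

(** A permutation of [n + 1] letters is determined by the position of its
largest letter and by the permutation left when that letter is removed. *)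
Lemma big_lift_perm (V : nmodType) n (f : 'S_n.+1 -> V) :
  \sum_(s : 'S_n.+1) f s =
  \sum_(s : 'S_n) \sum_(i < n.+1) f (lift_perm i ord_max s).
Proof.
rewrite exchange_big pair_big /=.
rewrite (reindex (fun p : 'I_n.+1 * 'S_n => lift_perm p.1 ord_max p.2)) //=.
apply: onW_bij; apply: inj_card_bij => [[i s] [j t] /= eq_st|]; last first.
  by rewrite card_prod card_ord !card_Sn factS.
have eqij : i = j.
  apply: (@perm_inj _ (lift_perm i ord_max s)).
  by rewrite lift_perm_id eq_st lift_perm_id.
rewrite -eqij in eq_st *; congr pair; apply/permP => k.
by apply: (@lift_inj _ ord_max); rewrite -!(lift_perm_lift i) eq_st.
Qed.

(** Each permutation with [d] descents extends in [d + 1] ways to one with [d]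
descents and in [n - d] ways to one with [d + 1] descents; the factors [d]
become a derivative. *)
Lemma descent_polyS (F : comNzRingType) n : descent_poly F n.+1 =
  (1 + 'X *+ n) * descent_poly F n + 'X * (1 - 'X) * (descent_poly F n)^`().
Proof.
rewrite /descent_poly big_lift_perm raddf_sum /= !mulr_sumr -big_split /=.
apply: eq_bigr => s _.
under eq_bigr do rewrite card_descents perm_word_lift.
have := sum_insert_letter_descents ('X : {poly F}) (perm_word_lt s).
rewrite size_perm_word => ->; rewrite -card_descents derivXn.
move: #|_| => d; rewrite -['X *+ n]mulr_natl.
suff in_ring (K : comNzRingType) (x : K) :
    d.+1%:R * x ^+ d + (n%:R - d%:R) * x ^+ d.+1 =
    (1 + n%:R * x) * x ^+ d + x * (1 - x) * (x ^+ d.-1 *+ d).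
  exact: in_ring.
case: d => [|d] /=; first by rewrite !mulr0n expr0 expr1; ring.
by rewrite -[_ *+ d.+1]mulr_natl !exprS;
    move: (x ^+ d) => y; ring.
Qed.

(** This is [B(y) + B(-y) = 2^(n+1) B(y^2)], for
[B(y) = y A_n(y) / (1 - y)^(n+1)], multiplied by [(1 - y^2)^(n+1)].  The
recurrence of [descent_polyS] says that [B] becomes its image by [y d/dy] when
[n] increases, and that operator commutes with [y -> -y] and turns [B(y^2)]
into twice its value at [y^2]. *)
Lemma descent_poly_duplication (F : comNzRingType) n :
  let A := descent_poly F n in
  'X * A * (1 + 'X) ^+ n.+1 - 'X * (A \Po - 'X) * (1 - 'X) ^+ n.+1
  = 2%:R ^+ n.+1 * 'X ^+ 2 * (A \Po 'X ^+ 2).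
Proof.
elim: n => [|n /= IHn]; first by rewrite /= descent_poly0 !comp_polyC; ring.
set A := descent_poly F n in IHn *.
(* The operator [y d/dy] on [B], seen on the numerator over
   [(1 - y^2)^(n+1)]. *)
have := congr1 (fun P => (1 - 'X ^+ 2) * 'X * P^`() +
  2%:R * (n%:R + 1) * 'X ^+ 2 * P) IHn.
have dX2 : ('X^2 : {poly F})^`() = 2%:R * 'X by rewrite derivXn -mulr_natl.
have dpow2 : ((2%:R : {poly F}) ^+ n.+1)^`() = 0.
  by rewrite -polyC_natr -polyC_exp derivC.
have dpow (e : {poly F}) : ((1 + e) ^+ n.+1)^`() =
    (n%:R + 1) * e^`() * (1 + e) ^+ n.
  by rewrite deriv_exp derivD derivC add0r natr1 -mulrA mulr_natl.
rewrite !(derivB, derivM, deriv_comp, dpow2, dX2, dpow, derivN, derivX).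
rewrite descent_polyS -/A -['X *+ n]mulr_natl.
have comp1 q : 1 \Po q = 1 :> {poly F} by rewrite comp_polyC.
have compn q : n%:R \Po q = n%:R :> {poly F}.
  by rewrite -polyC_natr comp_polyC.
rewrite !(comp_polyB, comp_polyD, comp_polyM, comp_polyX, comp1, compn).
rewrite ![_ ^+ n.+2]exprS ![_ ^+ n.+1]exprS.
move: (_ ^+ n) (_ ^+ n) (_ ^+ n) => two_n y1 y2.
move: {IHn} A (A^`()) (A \Po - 'X) (A^`() \Po - 'X)
  (A \Po 'X^2) (A^`() \Po 'X^2).
move=> A0 A1 B0 B1 C0 C1.
move: 'X (n%:R : {poly F}) => x N.
move=> eq_der.
match type of eq_der with ?L = _ => transitivity L end; first by ring.
by rewrite eq_der; ring.
Qed.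

(** * Descent polynomials on the unit circle *)

Section Expi.
Variable R : realType.
Implicit Types (x y : R) (z : R[i]).

Definition expi x : R[i] := (cos x +i* sin x)%C.

Lemma expiD x y : expi (x + y) = expi x * expi y.
Proof.
rewrite /expi cosD sinD; apply/eqP; rewrite eq_complex /= eqxx /=.
by apply/eqP; ring.
Qed.

Lemma expi0 : expi 0 = 1.
Proof. by rewrite /expi cos0 sin0. Qed.

Lemma expiMn x n : expi (x *+ n) = expi x ^+ n.
Proof. by elim: n => [|n IHn]; rewrite ?expi0 // mulrS expiD IHn exprS. Qed.

Lemma expiDpi x : expi (x + pi) = - expi x.
Proof. by rewrite /expi cosDpi sinDpi. Qed.

Lemma normc_expi x : normc (expi x) = 1.
Proof. by rewrite /= cos2Dsin2 sqrtr1. Qed.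

Lemma normcX z n : normc (z ^+ n) = normc z ^+ n.
Proof. by elim: n => [|n IHn]; rewrite ?normc1 // !exprS normcM IHn. Qed.

Lemma normc_nat n : normc (n%:R : R[i]) = n%:R.
Proof. by rewrite (@normcMn R) normc1. Qed.

Lemma normc_sum (I : Type) (r : seq I) (P : pred I) (f : I -> R[i]) :
  normc (\sum_(i <- r | P i) f i) <= \sum_(i <- r | P i) normc (f i).
Proof.
elim/big_ind2 : _ => [|a b c d ab cd|//]; first by rewrite normc0.
by apply: le_trans (le_normcD _ _) (lerD _ _).
Qed.

Lemma normc_1Dexpi x : normc (1 + expi (x *+ 2)) = 2 * `|cos x|.
Proof.
have -> : 1 + expi (x *+ 2) = (2 * cos x)%:C%C * expi x.
  apply/eqP; rewrite /expi eq_complex /= cos_mulr2n sin_mulr2n.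
  by apply/andP; split; apply/eqP; ring.
rewrite normcM normc_expi mulr1 /= expr0n addr0 sqrtr_sqr normrM.
by rewrite ger0_norm.
Qed.

Lemma normc_1Bexpi x : normc (1 - expi (x *+ 2)) = 2 * `|sin x|.
Proof.
have -> : 1 - expi (x *+ 2) = 1 + expi ((x + pi / 2) *+ 2).
  by rewrite mulrnDl -[pi / 2 *+ 2]mulr_natr divfK // expiDpi.
by rewrite normc_1Dexpi cosDpihalf normrN.
Qed.

Definition descent_modulus n x : R :=
  normc (descent_poly R[i] n).[expi (x *+ 2)] / n`!%:R.

Lemma descent_modulus_le1 n x : descent_modulus n x <= 1.
Proof.
rewrite ler_pdivrMr ?ltr0n ?fact_gt0 // mul1r horner_sum.
apply: le_trans (normc_sum _ _ _) _.
under eq_bigr do rewrite hornerXn normcX normc_expi expr1n.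
by rewrite sumr_const card_Sn.
Qed.

(** Evaluate the duplication identity at [y = expi x]: the arguments
[x / 2] and [(x + pi) / 2] have double angles with exponentials [y] and
[- y], and [|1 + y|], [|1 - y|] are [2 |cos (x / 2)|], [2 |sin (x / 2)|]. *)
Lemma descent_modulus_duplication n x :
  descent_modulus n x <=
    `|cos (x / 2)| ^+ n.+1 * descent_modulus n (x / 2) +
    `|sin (x / 2)| ^+ n.+1 * descent_modulus n ((x + pi) / 2).
Proof.
have halfK (t : R) : (t / 2) *+ 2 = t by rewrite -mulr_natr divfK.
rewrite /descent_modulus !mulrA -mulrDl ler_wpM2r ?invr_ge0 ?ler0n //.
rewrite !halfK expiDpi mulr2n expiD -expr2.
have := normc_1Dexpi (x / 2); have := normc_1Bexpi (x / 2); rewrite halfK.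
have := normc_expi x; move: (expi x) (cos _) (sin _) => y c s ny ns nc.
have /(congr1 (horner^~ y)) := descent_poly_duplication R[i] n.
rewrite !(hornerD, hornerN, hornerM, horner_exp, horner_comp, hornerX, hornerC).
move: (descent_poly R[i] n) => A eq_dup.
have {eq_dup} /(congr1 (@normc R)) : 2%:R ^+ n.+1 * (y * A.[y ^+ 2]) =
    A.[y] * (1 + y) ^+ n.+1 - A.[- y] * (1 - y) ^+ n.+1.
  have y0 : y != 0.
    by apply/eqP => y0; move/eqP: ny; rewrite y0 normc0 eq_sym oner_eq0.
  apply: (mulfI y0); rewrite mulrBr !mulrA eq_dup !expr2.
  by congr (_ * _); rewrite [y * 2%:R ^+ _]mulrC !mulrA.
rewrite 2!normcM normcX normc_nat ny mul1r => eq_dup.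
rewrite -(ler_pM2l (_ : 0 < 2 ^+ n.+1 :> R)) ?exprn_gt0 // eq_dup.
apply: le_trans (le_normcD _ _) _.
rewrite normcN !normcM !normcX ns nc !exprMn mulrDr ![normc A.[_] * _]mulrC.
by rewrite !mulrA.
Qed.

End Expi.

(** * The series of powers of sin x / (x + pi m) *)

Lemma bernoulli_ineq (R : realDomainType) (u : R) p :
  0 <= u <= 1 -> 1 - p%:R * u <= (1 - u) ^+ p.
Proof.
case/andP=> u0 u1; elim: p => [|p IHp]; first by rewrite mul0r subr0 expr0.
rewrite exprS (le_trans _ (ler_wpM2l _ IHp)) ?subr_ge0 //.
rewrite -natr1; have : 0 <= p%:R * u ^+ 2 by rewrite mulr_ge0 // sqr_ge0.
by nra.
Qed.

Lemma esum_int_dissection (R : realType) (b : nat) (F : int -> \bar R) :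
  (0 < b)%N -> (forall j, 0 <= F j)%E ->
  (\sum_(l < b) \esum_(m in [set: int]) F (l%:Z + m * b%:Z)%R =
   \esum_(j in [set: int]) F j)%E.
Proof.
move=> b0 F0; have bn0 : b%:Z != 0 by rewrite eqz_nat -lt0n.
transitivity (\sum_(l < b) \esum_(j in [set j : int | (j %% b)%Z = l]) F j)%E.
  apply: eq_bigr => l _; apply/esym.
  have lb : (0 <= l%:Z < b%:Z) by rewrite lez_nat ltz_nat ltn_ord.
  apply: (reindex_esum [set: int] [set j : int | (j %% b)%Z = l]
            (fun m : int => l%:Z + m * b%:Z)).
  split=> [m _|m1 m2 _ _ /addrI/(mulIf bn0)//|j /= jl].
    by rewrite /= addrC modzMDl modz_small.
  by exists (j %/ b)%Z => //; rewrite addrC -jl -divz_eq.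
under eq_bigr do rewrite esum_mkcond.
rewrite -esum_sum => [|j l _ _]; last by case: ifP.
apply: eq_esum => j _.
have ltjb : (`|(j %% b)%Z| < b)%N.
  by rewrite -ltz_nat gez0_abs ?modz_ge0 // ltz_pmod.
rewrite (bigD1 (Ordinal ltjb)) //= big1 => [|l /eqP neq_l].
  rewrite adde0 ifT //; apply/mem_set.
  by rewrite /= gez0_abs ?modz_ge0.
rewrite ifF //; apply/negP => /set_mem /= jl; apply: neq_l.
by apply/val_inj; rewrite /= jl.
Qed.

Lemma ge0_esumZl (R : realType) (T : choiceType) (S : set T)
    (F : T -> \bar R) (r : R) :
  0 <= r -> (forall i, 0 <= F i)%E ->
  (\esum_(i in S) (r%:E * F i) = r%:E * \esum_(i in S) F i)%E.
Proof.
move=> r0 F0; rewrite /esum -ereal_supZl //; last first.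
  by apply/set0P; exists 0%E, set0; [exact: fsets_set0|exact: fsbig_set0].
congr ereal_sup; apply/seteqP; split=> [_ [A SA <-]|_ [_ [A SA <-] <-]] /=.
  by exists (\sum_(i \in A) F i)%R; [exists A|exact: ge0_mule_fsumr].
by exists A; last exact/esym/ge0_mule_fsumr.
Qed.

Section Herglotz.
Variable R : realType.
Implicit Types x : R.

Lemma xcos_le_sin x : 0 < x <= pi / 2 -> x * cos x <= sin x.
Proof.
case/andP=> x0 xpi2.
have [c /andP[c0 cx] sinE] : exists2 c, c \in `]0, x[ &
    sin x - sin 0 = cos c * (x - 0) :> R.
  by apply: (MVT x0); apply: continuous_subspaceT; exact: continuous_sin.
have pi0 := pi_gt0 R.
rewrite -[sin x]subr0 -{1}(sin0 R) sinE subr0 mulrC ler_pM2r //.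
move: c0 cx; rewrite !bnd_simp => c0 cx; apply: ltW.
by rewrite ltr_cos // in_itv /=; apply/andP; split; lra.
Qed.

(** Since [cos x <= sin x / x], Bernoulli's inequality bounds the defect
[1 - (sin x / x)^p] by [p (1 - cos x)], and [1 <= cos x + sin x] on the first
quadrant. *)
Lemma one_sub_sinc_pow_le x p : 0 < x <= pi / 2 ->
  1 <= (sin x / x) ^+ p + p%:R * sin x.
Proof.
move=> x0pi2; have /andP[x0 xpi2] := x0pi2; have pi0 := pi_gt0 R.
have c0 : 0 <= cos x by apply: cos_ge0_pihalf; apply/andP; split; lra.
have s0 : 0 < sin x by apply: sin_gt0_pi; apply/andP; split; lra.
have sinc_ge : cos x <= sin x / x by rewrite ler_pdivlMr // mulrC xcos_le_sin.
have c_le1 := cos_le1 x.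
have cs1 : 1 <= cos x + sin x.
  by have := cos2Dsin2 x; rewrite !expr2; nra.
have : (1 - (1 - cos x)) ^+ p <= (sin x / x) ^+ p.
  by rewrite subKr; apply: lerXn2r; rewrite // nnegrE ltW // divr_gt0.
have : 1 - p%:R * (1 - cos x) <= (1 - (1 - cos x)) ^+ p.
  by apply: bernoulli_ineq; rewrite subr_ge0 c_le1 gerBl.
have : p%:R * (1 - cos x) <= p%:R * sin x by rewrite ler_wpM2l // lerBlDl.
lra.
Qed.

Definition sinc_series p x : \bar R :=
  (\esum_(m in [set: int]) (`|sin x / (x + pi * m%:~R)| ^+ p)%:E)%E.

Lemma sinc_series_ge p x m :
  ((`|sin x / (x + pi * m%:~R)| ^+ p)%:E <= sinc_series p x)%E.
Proof.
apply: esum_ge; exists [set m]; last by rewrite fsbig_set1.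
by split=> //; exact: finite_set1.
Qed.

Lemma sin_double_half x : sin x = 2 * (sin (x / 2) * cos (x / 2)).
Proof.
by rewrite -{1}[x](divfK (_ : 2 != 0)) // mulr_natr sin_mulr2n; ring.
Qed.

Lemma sin_halfDpi x : sin ((x + pi) / 2) = cos (x / 2).
Proof. by rewrite mulrDl sinDpihalf. Qed.

(** The even [m] make up the first summand and the odd [m] the second, because
[sin x = 2 sin (x / 2) cos (x / 2)] and
[x + pi (2 m) = 2 (x / 2 + pi m)],
[x + pi (2 m + 1) = 2 ((x + pi) / 2 + pi m)]. *)
Lemma sinc_series_duplication p x :
  sinc_series p x = 
  ((`|cos (x / 2)| ^+ p)%:E * sinc_series p (x / 2) +
   (`|sin (x / 2)| ^+ p)%:E * sinc_series p ((x + pi) / 2))%E.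
Proof.
have F0 (t : R) : (0 <= (`|t| ^+ p)%:E :> \bar R)%E.
  by rewrite lee_fin exprn_ge0.
rewrite {1}/sinc_series -(esum_int_dissection (ltn0Sn 1)) //.
rewrite !big_ord_recl big_ord0 adde0 /sinc_series -!ge0_esumZl ?exprn_ge0 //.
congr (_ + _)%E; apply: eq_esum => m _; rewrite -EFinM -exprMn -normrM;
  congr (`|_| ^+ _)%:E; rewrite sin_double_half ?sin_halfDpi rmorphD rmorphM /=.
- have -> : x + pi * (0%:~R + m%:~R * 2%:~R) = 2 * (x / 2 + pi * m%:~R) :> R.
    by field.
  by rewrite -mulf_div divff // mul1r [RHS]mulrCA mulrA.
- have -> : x + pi * ((bump 0 0)%:~R + m%:~R * 2%:~R) =
      2 * ((x + pi) / 2 + pi * m%:~R) :> R by rewrite /bump /=; field.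
  by rewrite -mulf_div divff // mul1r mulrA.
Qed.

(** Herglotz' trick: the error of [one_sub_sinc_pow_le] is proportional to
[sin], and the duplication relation contracts such an error by [3/4].  The
series is an extended real, so the error is added to it instead of being
subtracted from [q]. *)
Lemma le_sinc_series (q : R -> R) p : (1 < p)%N ->
  (forall x, 0 < x < pi -> q x <= 1) ->
  (forall x, 0 < x < pi -> q x <= `|cos (x / 2)| ^+ p * q (x / 2) +
                    `|sin (x / 2)| ^+ p * q ((x + pi) / 2)) ->
  forall x, 0 < x < pi -> ((q x)%:E <= sinc_series p x)%E.
Proof.
move=> p1 q1 qdup; have pi0 := pi_gt0 R.
have approx k : forall x, 0 < x < pi ->
    ((q x)%:E <= sinc_series p x + (p%:R * (3 / 4) ^+ k * sin x)%:E)%E.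
  (* The nearest term is [m = 0] on the first half of the interval and
     [m = -1] on the second. *)
  elim: k => [|k IHk] x x0pi;
    have s0 := sin_gt0_pi x0pi; case/andP: (x0pi) => x0 xpi.
    rewrite expr0 mulr1.
    have [xpi2|xpi2] := leP x (pi / 2).
      apply: le_trans (leeD (sinc_series_ge p x 0) (le_refl _)).
      rewrite mulr0 addr0 -EFinD lee_fin (le_trans (q1 _ x0pi)) //.
      rewrite ger0_norm; last by rewrite ltW // divr_gt0.
      by apply: one_sub_sinc_pow_le; rewrite x0.
    apply: le_trans (leeD (sinc_series_ge p x (-1)) (le_refl _)).
    rewrite -EFinD lee_fin (le_trans (q1 _ x0pi)) // mulrN1.
    rewrite normrM normfV distrC ger0_norm ?(ltW s0) //.
    rewrite ger0_norm ?subr_ge0 ?(ltW xpi) //.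
    have -> : sin x = sin (pi - x) by rewrite addrC sinDpi sinN opprK.
    by apply: one_sub_sinc_pow_le; apply/andP; split; lra.
  have h1 : 0 < x / 2 < pi by apply/andP; split; lra.
  have h2 : 0 < (x + pi) / 2 < pi by apply/andP; split; lra.
  have := qdup _ x0pi; rewrite -lee_fin => /le_trans; apply.
  rewrite EFinD !EFinM sinc_series_duplication.
  have c0 : 0 < cos (x / 2) by apply: cos_gt0_pihalf; apply/andP; split; lra.
  have sh0 := sin_gt0_pi h1.
  have := leeD (lee_wpmul2l (_ : (0 <= (`|cos (x / 2)| ^+ p)%:E)%E) (IHk _ h1))
    (lee_wpmul2l (_ : (0 <= (`|sin (x / 2)| ^+ p)%:E)%E) (IHk _ h2)).
  rewrite !lee_fin !exprn_ge0 // => /(_ isT isT) /le_trans; apply.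
  rewrite !muleDr ?fin_num_adde_defl //.
  rewrite addeACA leeD2l // -!EFinM -EFinD lee_fin.
  rewrite !gtr0_norm // sin_halfDpi (sin_double_half x).
  have := cos2Dsin2 (x / 2).
  move: (sin _) (cos _) c0 sh0 => s c {s0} c0 s0.
  move=> {qdup q1 IHk}; case: p p1 => [|[|r]] // _ c2s2.
  have [c1 s1] : c <= 1 /\ s <= 1 by split; move: c2s2; rewrite !expr2; nra.
  have cr : c ^+ r.+1 <= c by rewrite exprS ger_pMr // exprn_ile1 // ltW.
  have sr : s ^+ r.+1 <= s by rewrite exprS ger_pMr // exprn_ile1 // ltW.
  have cs : c + s <= 3 / 2 by move: c2s2; rewrite !expr2; nra.
  have e0 : 0 <= r.+2%:R * (3 / 4) ^+ k * (s * c).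
    by rewrite !mulr_ge0 ?exprn_ge0 // ?ltW // divr_ge0.
  rewrite ![_ ^+ r.+2]exprSr.
  have := ler_wpM2l e0 (le_trans (lerD cr sr) cs).
  rewrite [_ ^+ k.+1]exprS; move: (_ ^+ k) (_ ^+ r.+1) (_ ^+ r.+1) (r.+2%:R).
  by move=> l cp sp n; congr (_ <= _); field.
move=> x x0pi; apply/lee_addgt0Pr => e e0.
have : (fun k => p%:R * (3 / 4) ^+ k * sin x) @ \oo --> (0 : R).
  have -> : 0 = p%:R * 0 * sin x :> R by rewrite mulr0 mul0r.
  apply: cvgM; last exact: cvg_cst.
  apply: cvgM; first exact: cvg_cst.
  by apply: cvg_expr; rewrite ger0_norm; lra.
move=> /cvgr0_norm_lt/(_ _ e0)[k _ /(_ k (leqnn k))] /= ltk.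
apply: le_trans (approx k x x0pi) _; rewrite leeD2l // lee_fin ltW //.
exact: le_lt_trans (ler_norm _) ltk.
Qed.
End Herglotz.

(** * Root-of-unity filter *)

Lemma card_descents_lt n (s : 'S_n) : (0 < n)%N -> (#|descents s| < n)%N.
Proof.
case: n s => // n s _.
rewrite -[X in (_ < X)%N]card_ord -[X in (_ < X)%N]cardsT.
apply: proper_card; rewrite properE finset.subsetT /=.
apply/subsetPn; exists ord_max; rewrite ?finset.inE //.
by apply/existsPn => j; rewrite (ltn_eqF (ltn_ord j)).
Qed.

(** A nonempty word of length [n] has fewer than [n] descents, so the values
[r < n] sort all permutations. *)
Lemma eulerian_residue_sumE n b k : (0 < n)%N ->
  (eulerian_residue_sum n b k =
   \sum_(s : 'S_n) (#|descents s| == k %[mod b]))%N.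
Proof.
move=> n0; rewrite /eulerian_residue_sum big_mkord -big_mkcond /=.
pose d (s : 'S_n) := Ordinal (card_descents_lt s n0).
rewrite (partition_big d (fun r : 'I_n => r == k %[mod b])) //=.
apply: eq_bigr => r rk; rewrite /eulerian -sum1_card; apply: eq_bigl => s.
rewrite finset.inE -val_eqE /=.
by case: eqP => [->|]; rewrite ?rk ?andbF.
Qed.

Section Filter.
Variable R : realType.

Lemma expi_turns e : expi (pi * e%:R *+ 2) = 1 :> R[i].
Proof.
rewrite mulr_natr -mulrnA mulnC mulrnA expiMn.
by rewrite /expi cos2pi sin2pi expr1n.
Qed.

Lemma pi_frac_itv (l b : nat) : (0 < l < b)%N ->
  0 < (pi : R) * l%:R / b%:R < pi.
Proof.
case/andP=> l0 lb; have b0 : (0 < b)%N := ltn_trans l0 lb.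
rewrite divr_gt0 ?mulr_gt0 ?pi_gt0 ?ltr0n //=.
by rewrite ltr_pdivrMr ?ltr0n // ltr_pM2l ?pi_gt0 // ltr_nat.
Qed.

Lemma expi_eq1 (b e : nat) : (0 < b)%N ->
  (expi (pi * e%:R / b%:R *+ 2) == 1 :> R[i]) = (b %| e)%N.
Proof.
move=> b0; have bn0 : b%:R != 0 :> R by rewrite pnatr_eq0 -lt0n.
rewrite {1}(divn_eq e b) natrD natrM mulrDr mulrDl mulrA mulfK //.
rewrite mulrnDl expiD expi_turns mul1r.
have [e_b|] := posnP (e %% b)%N.
  by rewrite /dvdn e_b mulr0 mul0r mul0rn expi0 !eqxx.
rewrite /dvdn lt0n => emod0; rewrite (negPf emod0); apply/negP => /eqP one.
have := normc_1Bexpi (pi * (e %% b)%N%:R / b%:R : R); rewrite one subrr normc0.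
have : 0 < sin (pi * (e %% b)%:R / b%:R : R).
  by apply/sin_gt0_pi/pi_frac_itv; rewrite lt0n emod0 ltn_pmod.
by move=> s0 /eqP; rewrite gtr0_norm // eq_sym mulf_eq0 gt_eqF //= gt_eqF.
Qed.

(** The summand is [z ^+ l] for the [b]-th root of unity
[z = expi (2 pi e / b)], so the sum is geometric. *)
Lemma sum_expi (b e : nat) : (0 < b)%N ->
  \sum_(l < b) expi (pi * l%:R / b%:R *+ 2) ^+ e =
    if (b %| e)%N then b%:R else 0 :> R[i].
Proof.
move=> b0; have bn0 : b%:R != 0 :> R by rewrite pnatr_eq0 -lt0n.
pose z : R[i] := expi (pi * e%:R / b%:R *+ 2).
transitivity (\sum_(l < b) z ^+ l).
  apply: eq_bigr => l _; rewrite -!expiMn; congr expi.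
  by rewrite -!mulrnA -[LHS]mulr_natr -[RHS]mulr_natr !natrM; ring.
rewrite -(expi_eq1 e b0) -/z; case: eqP => [->|/eqP].
  by under eq_bigr do rewrite expr1n; rewrite sumr_const card_ord.
rewrite -subr_eq0 => zn1; apply/(mulfI zn1); rewrite mulr0 -subrX1 -expiMn.
rewrite -mulrnA mulnC mulrnA -[_ *+ b]mulr_natr divfK //.
by rewrite expi_turns subrr.
Qed.

(** The exponent [b - k] replaces [- k], which keeps all powers natural. *)
Lemma residue_sum_filter n b k : (0 < n)%N -> (k < b)%N ->
  (eulerian_residue_sum n b k)%:R * b%:R =
  \sum_(l < b) expi (pi * l%:R / b%:R *+ 2) ^+ (b - k) *
               (descent_poly R[i] n).[expi (pi * l%:R / b%:R *+ 2)].
Proof.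
move=> n0 kb; have b0 : (0 < b)%N by exact: leq_trans kb.
under eq_bigr => l _.
  rewrite /descent_poly horner_sum mulr_sumr.
  under eq_bigr => s _ do rewrite hornerXn -exprD.
  over.
rewrite exchange_big eulerian_residue_sumE // natr_sum mulr_suml /=.
apply: eq_bigr => s _; rewrite sum_expi // addnBAC 1?ltnW // [(b + _)%N]addnC.
rewrite -eqn_mod_dvd ?modnDr; last exact: leq_trans (ltnW kb) (leq_addl _ _).
by case: eqP; rewrite ?mul1r ?mul0r.
Qed.

(** The term [l = 0] of the filter is [A_n(1) = n!], which cancels [1/b]; in
the others the twist [expi _ ^+ (b - k)] has modulus [1]. *)
Lemma residue_sum_le n b k : (0 < n)%N -> (k < b)%N ->
  `| (n`!%:R)^-1 * (eulerian_residue_sum n b k)%:R - b%:R^-1 | <=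
  b%:R^-1 * \sum_(l < b | l != 0%N :> nat)
     descent_modulus n (pi * l%:R / b%:R) :> R.
Proof.
move=> n0 kb; have b0 : (0 < b)%N by exact: leq_trans kb.
have bn0 : b%:R != 0 :> R by rewrite pnatr_eq0 -lt0n.
have n0' : n`!%:R != 0 :> R by rewrite pnatr_eq0 -lt0n fact_gt0.
rewrite (_ : _ - _ = b%:R^-1 * (n`!%:R^-1 *
  ((eulerian_residue_sum n b k)%:R * b%:R - n`!%:R))); last first.
  by field; apply/andP.
rewrite !normrM !normfV !normr_nat ler_wpM2l ?invr_ge0 //.
rewrite /descent_modulus -mulr_suml mulrC ler_wpM2r ?invr_ge0 //.
have -> (r : R) : `|r| = normc r%:C%C by rewrite /= expr0n addr0 sqrtr_sqr.
rewrite rmorphB rmorphM !rmorph_nat residue_sum_filter //.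
rewrite (bigD1 (Ordinal b0)) //= mulr0 mul0r mul0rn expi0 expr1n mul1r.
have -> : (descent_poly R[i] n).[1] = n`!%:R.
  rewrite horner_sum; under eq_bigr do rewrite hornerXn expr1n.
  by rewrite sumr_const card_Sn.
rewrite addrAC subrr add0r; apply: le_trans (normc_sum _ _ _) _.
by apply: ler_sum => l _; rewrite normcM normcX normc_expi expr1n mul1r.
Qed.
End Filter.

(** * Conclusion *)

Lemma norm_sinD_intpi (R : realType) (x : R) (m : int) :
  `|sin (x + pi * m%:~R)| = `|sin x|.
Proof.
have natural (n : nat) (y : R) : `|sin (y + pi * n%:R)| = `|sin y|.
  elim: n => [|n IHn]; first by rewrite mulr0 addr0.
  by rewrite -natr1 mulrDr mulr1 addrA sinDpi normrN.
case: m => n; first exact: natural.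
by rewrite -(natural n.+1 (x + _)) NegzE mulrNz mulrN subrK.
Qed.

Theorem theorem3p1 (R : realType) (n b k : nat)
    (hn : (1 <= n)%N) (hb : (2 <= b)%N) (hk : (k < b)%N) :
  (`| (n`!%:R)^-1 * (eulerian_residue_sum n b k)%:R - b%:R^-1 : R |%:E <=
   (b%:R^-1 : R)%:E *
     \esum_(j in [set j : int | j != 0%R])
        (`| b%:R * sin (pi * j%:~R / b%:R) / (pi * j%:~R) : R | ^+ n.+1)%:E)%E.
Proof.
have b0 : (0 < b)%N by exact: leq_trans hb.
have bR0 : 0 < b%:R :> R by rewrite ltr0n.
have := residue_sum_le R hn hk; rewrite -lee_fin EFinM => /le_trans; apply.
rewrite lee_wpmul2l ?lee_fin ?invr_ge0 ?ler0n //.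
pose F (j : int) :=
  (`| b%:R * sin (pi * j%:~R / b%:R) / (pi * j%:~R) : R | ^+ n.+1)%:E.
have F0 j : (0 <= F j)%E by rewrite lee_fin exprn_ge0.
(* At [j = 0] the summand is [0], inverses of [0] being [0]. *)
have -> : (\esum_(j in [set j : int | j != 0%R]) F j =
           \esum_(j in [set: int]) F j)%E.
  rewrite esum_mkcond; apply: eq_esum => j _; case: ifPn => //.
  move=> /negP jn; have [->|j0] := eqVneq j 0; last by case: jn; exact/mem_set.
  by rewrite /F mulr0 invr0 mulr0 normr0 expr0n.
(* The class [l = 0] contributes nonnegatively and is dropped. *)
rewrite -(esum_int_dissection b0 F0) [leRHS](bigD1 (Ordinal b0)) //=.
rewrite -sumEFin.
apply: (@le_trans _ _ (\sum_(l < b | l != Ordinal b0) 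
   \esum_(m in [set: int]) F (l%:Z + m * b%:Z)%R)%E); last first.
  by rewrite leeDr //; apply: esum_ge0.
apply: lee_sum => l l0.
have x0pi : 0 < (pi : R) * l%:R / b%:R < pi.
  by apply: pi_frac_itv; rewrite lt0n l0 ltn_ord.
have := @le_sinc_series _ (descent_modulus n) n.+1 hn
   (fun x _ => descent_modulus_le1 n x)
   (fun x _ => descent_modulus_duplication n x) _ x0pi.
move=> /le_trans; apply; apply: le_esum => m _.
have bn0 : b%:R != 0 :> R by rewrite gt_eqF.
have jE : pi * (l%:Z + m * b%:Z)%:~R =
    b%:R * (pi * l%:R / b%:R + pi * m%:~R) :> R.
  by rewrite rmorphD rmorphM /=; field.
rewrite lee_fin jE [b%:R * _ / b%:R]mulrAC divff // mul1r.
rewrite -mulf_div divff // mul1r.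
by rewrite !normrM norm_sinD_intpi.
Qed.
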